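(* Let $N\ge 2$, let $f_1,\dots,f_N:\mathbb{R}^n\to\mathbb{R}$ be convex, $F=\sum_{i=1}^N f_i$, and let the Selective Linearization (SLIN) algorithm be run with $\varepsilon=0$, generating proximal centers $x^k$. Suppose that the set $\mathcal{K}=\{1\}\cup\{k>1: x^k\ne x^{k-1}\}$ is finite and that $\inf F>-\infty$. Let $m$ be the largest element of $\mathcal{K}$. Then $x^m\in\operatorname{Argmin}F$, i.e. $x^m$ is a minimizer of $F$ over $\mathbb{R}^n$.
   Context: Notation: $D$ is a fixed symmetric positive definite $n\times n$ matrix, $\|x\|_D=\langle x,Dx\rangle^{1/2}$. SLIN algorithm (stopping precision $\varepsilon$, parameter $\beta\in(0,1)$), for minimizing $F=\sum_{i=1}^N f_i$: Step 0. Set $k=1$, choose $j_1\in\{1,\dots,N\}$, $x^1\in\mathbb{R}^n$, and for all $i\ne j_1$ points $z_i^1\in\mathbb{R}^n$ and subgradients $g_i^1\in\partial f_i(z_i^1)$. At every iteration, put $\tilde f_i^k(x)=f_i(z_i^k)+\langle g_i^k,x-z_i^k\rangle$ and $\tilde F^k(x)=f_{j_k}(x)+\sum_{i\neq j_k}\tilde f_i^k(x)$. Step 1. Let $z^k_{j_k}$ be the (unique) solution of $\min_x \tilde F^k(x)+\frac12\|x-x^k\|_D^2$, and set $g^k_{j_k}=-\sum_{i\ne j_k}g_i^k-D(z^k_{j_k}-x^k)$ (this is a subgradient of $f_{j_k}$ at $z^k_{j_k}$). Step 2. If $F(x^k)-\tilde F^k(z^k_{j_k})\le\varepsilon$, stop.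 Otherwise continue. Step 3. If $F(z^k_{j_k})\le F(x^k)-\beta\big(F(x^k)-\tilde F^k(z^k_{j_k})\big)$, set $x^{k+1}=z^k_{j_k}$ (descent step); otherwise set $x^{k+1}=x^k$ (null step). Step 4. Select $j_{k+1}\in\arg\max_{i\ne j_k}\{f_i(z^k_{j_k})-\tilde f_i^k(z^k_{j_k})\}$. For all $i\ne j_{k+1}$ set $z_i^{k+1}=z_i^k$, $g_i^{k+1}=g_i^k$ (so $\tilde f_i^{k+1}\equiv\tilde f_i^k$; for $i=j_k$ this uses $z^k_{j_k},g^k_{j_k}$ from Step 1). Increase $k$ by 1 and go to Step 1. The index $k$ ranges over the iterations actually performed (the algorithm may stop after finitely many iterations or run forever). *)

(* Defs.v *)
From HB Require Import structures.
From mathcomp Require Import all_boot all_order all_algebra.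
From mathcomp Require Import all_classical all_reals all_analysis.

Set Implicit Arguments.
Unset Strict Implicit.
Unset Printing Implicit Defensive.

Import Order.TTheory GRing.Theory Num.Theory.
Local Open Scope classical_set_scope.
Local Open Scope ring_scope.

Section ConvexAnalysis.
Context {R : realType} {n : nat}.
Implicit Types (x y z g : 'cV[R]_n) (D : 'M[R]_n) (h : 'cV[R]_n -> R).

Definition inner x y : R := (x^T *m y) 0 0.

Definition sympd D : Prop :=
  D^T = D /\ forall x, x != 0 -> 0 < inner x (D *m x).

Definition normD D x : R := Num.sqrt (inner x (D *m x)).

Definition Argmin h : set 'cV[R]_n := [set x | forall y, h x <= h y].

Definition subdifferential h z : set 'cV[R]_n :=
  [set g | forall y, h z + inner g (y - z) <= h y].

End ConvexAnalysis.

Section SLIN.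
Context {R : realType} {n N : nat}.
Variables (f : 'I_N -> 'cV[R]_n -> R) (D : 'M[R]_n) (eps beta : R).

Definition objective (x : 'cV[R]_n) : R := \sum_i f i x.

(* The iterates: [x k] is the proximal center, [j k] the index of the function
   kept exact, and [z k i], [g k i] the linearization points and subgradients.
   Iterations are numbered from 1, so values at index 0 are never used. *)
Variables (x : nat -> 'cV[R]_n) (j : nat -> 'I_N)
  (z g : nat -> 'I_N -> 'cV[R]_n).

Definition lin (k : nat) (i : 'I_N) (y : 'cV[R]_n) : R :=
  f i (z k i) + inner (g k i) (y - z k i).

Definition model (k : nat) (y : 'cV[R]_n) : R :=
  f (j k) y + \sum_(i | i != j k) lin k i y.

Definition prox (k : nat) : 'cV[R]_n := z k (j k).

Definition gap (k : nat) : R := objective (x k) - model k (prox k).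

(* The stopping test fails at every earlier iteration; hence the performed
   iterations are all k >= 1, or those up to and including the first one at
   which the stopping test succeeds. *)
Definition performed (k : nat) : Prop :=
  (1 <= k)%N /\ forall l, (1 <= l < k)%N -> eps < gap l.

(* Nothing is required of the sequences beyond the last performed iteration. *)
Record slin_run : Prop := SlinRun {
  slin_init : forall i, i != j 1 -> subdifferential (f i) (z 1 i) (g 1 i);
  slin_prox : forall k, performed k ->
    Argmin (fun y => model k y + 2^-1 * normD D (y - x k) ^+ 2) (prox k);
  slin_subgrad : forall k, performed k ->
    g k (j k) = - \sum_(i | i != j k) g k i - D *m (prox k - x k);
  slin_center : forall k, performed k.+1 -> (1 <= k)%N ->
    x k.+1 = if objective (prox k) <= objective (x k) - beta * gap k
             then prox k else x k;
  slin_select : forall k, performed k.+1 -> (1 <= k)%N ->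
    j k.+1 != j k /\
    forall i, i != j k ->
      f i (prox k) - lin k i (prox k) <=
      f (j k.+1) (prox k) - lin k (j k.+1) (prox k);
  slin_keep : forall k, performed k.+1 -> (1 <= k)%N ->
    forall i, i != j k.+1 -> z k.+1 i = z k i /\ g k.+1 i = g k i
}.

Definition center_changes : set nat :=
  [set k | k = 1%N \/ [/\ (1 < k)%N, performed k & x k != x k.-1]].

End SLIN.

(* Main.v *)
Require Import Defs.
From HB Require Import structures.
From mathcomp Require Import all_boot all_order all_algebra.
From mathcomp Require Import all_classical all_reals all_analysis.
From mathcomp Require Import ring lra.

Import Order.TTheory GRing.Theory Num.Theory.
Local Open Scope classical_set_scope.
Local Open Scope ring_scope.

(* Every linearization minorizes its convex function, so models minorize F and
   F(y) + |y - x^k|_D^2 / 2 >= F(x^k) - gap_k for all y.  If the gap is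
   arbitrarily small (or nonpositive) at iterations with center x^m, then x^m
   minimizes F + |. - x^m|_D^2 / 2, hence, by convexity, F.  After the last
   center change, if the method does not stop, the optimal values of the
   proximal subproblems increase by at least |z^{k+1} - z^k|_D^2 / 2 plus the
   linearization error of the newly exact function at z^{k+1}, and they are
   bounded by F(x^m).  So some increment is small; convexity and local
   boundedness move the small error from z^{k+1} to z^k, where, by the
   selection rule and the failure of the descent test, it controls the gap. *)

(** * Bilinearity of the inner product *)

Section Inner.
Context {R : realType} {n : nat}.
Implicit Types (u v y : 'cV[R]_n) (D : 'M[R]_n).

Lemma innerC u v : inner u v = inner v u.
Proof.
have -> : inner u v = (u^T *m v)^T 0 0 by rewrite mxE.
by rewrite trmx_mul trmxK.
Qed.

Lemma innerDl u v y : inner (u + v) y = inner u y + inner v y.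
Proof. by rewrite /inner linearD mulmxDl mxE. Qed.

Lemma innerDr u v y : inner y (u + v) = inner y u + inner y v.
Proof. by rewrite innerC innerDl !(innerC _ y). Qed.

Lemma innerZl a u v : inner (a *: u) v = a * inner u v.
Proof. by rewrite /inner linearZ -scalemxAl mxE. Qed.

Lemma innerZr a u v : inner u (a *: v) = a * inner u v.
Proof. by rewrite innerC innerZl innerC. Qed.

Lemma innerNl u v : inner (- u) v = - inner u v.
Proof. by rewrite -scaleN1r innerZl mulN1r. Qed.

Lemma innerNr u v : inner u (- v) = - inner u v.
Proof. by rewrite innerC innerNl innerC. Qed.

Lemma inner_suml (I : finType) (P : pred I) (a : I -> 'cV[R]_n) v :
  inner (\sum_(i | P i) a i) v = \sum_(i | P i) inner (a i) v.
Proof. by rewrite /inner linear_sum mulmx_suml summxE. Qed.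

Lemma inner_delta i u : inner (delta_mx i 0) u = u i 0.
Proof.
rewrite /inner mxE (bigD1 i) //= big1 ?addr0 ?mxE ?eqxx ?mul1r // => k ki.
by rewrite !mxE (negbTE ki) mul0r.
Qed.

End Inner.

(** * Quadratic identities and coordinate bounds for the D-norm *)

Section EllipsoidalNorm.
Context {R : realType} {n : nat} {D : 'M[R]_n}.
Hypothesis hD : sympd D.
Implicit Types u v y : 'cV[R]_n.

Lemma inner_sympd u v : inner u (D *m v) = inner v (D *m u).
Proof. by rewrite innerC /inner trmx_mul hD.1 mulmxA. Qed.

Lemma normD_sqr u : normD D u ^+ 2 = inner u (D *m u).
Proof.
rewrite sqr_sqrtr //; have [->|/hD.2/ltW//] := eqVneq u 0.
by rewrite /inner mulmx0 mulmx0 mxE.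
Qed.

Lemma normD_sqrD u v :
  normD D (u + v) ^+ 2 =
  normD D u ^+ 2 + 2 * inner v (D *m u) + normD D v ^+ 2.
Proof.
rewrite !normD_sqr mulmxDr innerDl !innerDr (inner_sympd u v); ring.
Qed.

Lemma normD_sqrZ a u : normD D (a *: u) ^+ 2 = a ^+ 2 * normD D u ^+ 2.
Proof. by rewrite !normD_sqr -scalemxAr innerZl innerZr; ring. Qed.

Lemma normD_sqrN u : normD D (- u) ^+ 2 = normD D u ^+ 2.
Proof. by rewrite -scaleN1r normD_sqrZ sqrrN expr1n mul1r. Qed.

(** The parallelogram law with the term in [u - v] dropped. *)
Lemma normD_sqrD_le u v :
  normD D (u + v) ^+ 2 <= 2 * normD D u ^+ 2 + 2 * normD D v ^+ 2.
Proof.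
have := sqr_ge0 (normD D (u - v)).
rewrite !normD_sqrD innerNl normD_sqrN; lra.
Qed.

Lemma sympd_unitmx : D \in unitmx.
Proof.
rewrite -row_free_unit -kermx_eq0; apply/rowV0P => v /sub_kermxP vD.
apply/eqP; apply: contraT => v0.
have /hD.2 : v^T != 0 by rewrite -[0]trmx0 (inj_eq trmx_inj).
by rewrite /inner trmxK mulmxA vD mul0mx mxE ltxx.
Qed.

(** Coordinate i equals [inner u (D *m a)] for a = D^-1 e_i, and expanding |a + u|_D^2 and |a -
    u|_D^2 bounds it. This puts D-balls inside boxes. *)
Lemma normr_coord_le i :
  exists A : R, forall u, `|u i 0| <= A + normD D u ^+ 2.
Proof.
pose a : 'cV[R]_n := invmx D *m delta_mx i 0.
have Da u : inner u (D *m a) = u i 0.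
  by rewrite /a mulKVmx ?sympd_unitmx // innerC inner_delta.
exists (normD D a ^+ 2) => u.
have := sqr_ge0 (normD D (a + u)); have := sqr_ge0 (normD D (a - u)).
rewrite !normD_sqrD normD_sqrN innerNl Da.
have := sqr_ge0 (normD D a); have := sqr_ge0 (normD D u).
by rewrite ler_norml => *; apply/andP; split; lra.
Qed.

End EllipsoidalNorm.

(** * Convexity on segments and upper bounds on boxes *)

Section Convex.
Context {R : realType} {n : nat}.
Implicit Types (h : 'cV[R]_n -> R) (u v y : 'cV[R]_n).

Lemma convex_function_line h u v t :
    convex_function [set: convex_lmodType 'cV[R]_n] h -> 0 <= t <= 1 ->
  h (u + t *: (v - u)) <= h u + t * (h v - h u).
Proof.
move=> hc /andP[t0 t1].
have H : h (t *: v + (1 - t) *: u) <= t * h v + (1 - t) * h u.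
  exact: (hc (Itv01 t0 t1) v u (mem_setT _) (mem_setT _)).
suff -> : u + t *: (v - u) = t *: v + (1 - t) *: u.
  by apply: (le_trans H); lra.
by rewrite scalerBr scalerBl scale1r addrCA; congr (_ + _).
Qed.

(** Induction on the list [s] of coordinates allowed to be nonzero: [y] is the midpoint of [u],
    whose coordinate i vanishes, and [v] on axis i. Both double coordinates of [y], so [M] varies in
    the induction. *)
Lemma convex_bounded_above_box h (s : seq 'I_n) M :
    convex_function [set: convex_lmodType 'cV[R]_n] h -> 0 < M ->
  exists C, forall y, (forall i, i \notin s -> y i 0 = 0) ->
    (forall i, `|y i 0| <= M) -> h y <= C.
Proof.
move=> hc; elim: s M => [|i s IH] M M0.
  exists (h 0) => y y0 _; suff -> : y = 0 by [].
  by apply/colP => i; rewrite y0 // mxE.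
have [C hC] := IH (2 * M) ltac:(lra).
pose e : 'cV[R]_n := delta_mx i 0.
exists (2^-1 * (C + `|h ((2 * M) *: e)| + `|h (- (2 * M) *: e)|)) => y y0 yM.
pose u := 2 *: (y - y i 0 *: e).
have hu : h u <= C.
  apply: hC => k; rewrite !mxE eqxx andbT; case: eqP => [->|/eqP ki] /=.
  - by rewrite mulr1 subrr mulr0.
  - by move=> ks; rewrite mulr0 subr0 y0 ?mulr0 // inE negb_or ki.
  - by rewrite mulr1 subrr mulr0 normr0; lra.
  - by rewrite mulr0 subr0 normrM ger0_norm // ler_wpM2l.
pose v := (2 * y i 0) *: e.
have /andP[yi0 yi1] : - M <= y i 0 <= M by rewrite -ler_norml.
have hv : h v <= `|h ((2 * M) *: e)| + `|h (- (2 * M) *: e)|.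
  (* The position of [v] on the segment from -2M e to 2M e. *)
  have t01 : 0 <= (y i 0 + M) / (2 * M) <= 1.
    by apply/andP; split; [apply: divr_ge0 | rewrite ler_pdivrMr]; lra.
  have := convex_function_line h (- (2 * M) *: e) ((2 * M) *: e) _ hc t01.
  have -> : - (2 * M) *: e +
      ((y i 0 + M) / (2 * M)) *: ((2 * M) *: e - - (2 * M) *: e) = v.
    by rewrite -scalerBl scalerA -scalerDl; congr (_ *: _); field; lra.
  move: (h v) (h ((2 * M) *: e)) (h (- (2 * M) *: e)) t01 => a b c; set t := _ / _ => /andP[t0 t1].
  have := ler_norm b; have := ler_norm c.
  have := normr_ge0 b; have := normr_ge0 c; nra.
have := convex_function_line h v u (2^-1) hc ltac:(lra).
have -> : v + 2^-1 *: (u - v) = y.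
  by apply/colP => k; rewrite !mxE; set d := (_ && _)%:R; field.
lra.
Qed.

End Convex.

(** * Local bounds, proximal optimality and linearization errors *)

Section ConvexEllipsoid.
Context {R : realType} {n : nat} {D : 'M[R]_n}.
Hypothesis hD : sympd D.
Implicit Types (h : 'cV[R]_n -> R) (u v y p c g : 'cV[R]_n).

Lemma convex_bounded_above h M :
    convex_function [set: convex_lmodType 'cV[R]_n] h ->
  exists C, forall y, normD D y ^+ 2 <= M -> h y <= C.
Proof.
move=> hc; have /choice[A hA] := normr_coord_le hD.
have B0 : 0 < \sum_i `|A i| + `|M| + 1.
  by rewrite ltr_wpDl // addr_ge0 ?sumr_ge0.
have [C hC] := convex_bounded_above_box h (enum 'I_n) _ hc B0.
exists C => y yM; apply: hC => i; first by rewrite mem_enum.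
apply: le_trans (hA i y) _; rewrite (bigD1 i) //=.
have := ler_norm (A i); have := ler_norm M.
have : 0 <= \sum_(k | k != i) `|A k| by rewrite sumr_ge0.
lra.
Qed.

(** The lower bound comes from reflection: 0 is the midpoint of [y] and [- y], so h(y) >= 2 h(0) -
    h(-y). *)
Lemma convex_bounded h M :
    convex_function [set: convex_lmodType 'cV[R]_n] h ->
  exists C, forall y, normD D y ^+ 2 <= M -> `|h y| <= C.
Proof.
move=> hc; have [C hC] := convex_bounded_above h M hc.
exists (`|C| + 2 * `|h 0|) => y yM.
have := hC _ yM; have /hC : normD D (- y) ^+ 2 <= M by rewrite normD_sqrN.
have := convex_function_line h y (- y) (2^-1) hc ltac:(lra).
have -> : y + 2^-1 *: (- y - y) = 0 by apply/colP => i; rewrite !mxE; field.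
have := ler_norm C; have := ler_norm (- h 0); have := normr_ge0 (h 0).
by rewrite normrN ler_norml => *; apply/andP; split; lra.
Qed.

Lemma linear_coef_ge0 (a b : R) :
  (forall t, 0 < t <= 1 -> 0 <= t * a + t ^+ 2 * b) -> 0 <= a.
Proof.
move=> H; rewrite leNgt; apply/negP => a0.
have b1 : 0 < - a + `|b| by have := normr_ge0 b; lra.
(* For this t, t|b| < -a/2, so the first-order term dominates and the sum is negative. *)
have t1 : 0 < - a / (2 * (- a + `|b|)) <= 1.
  by apply/andP; split; [apply: divr_gt0 | rewrite ler_pdivrMr];
    have := normr_ge0 b; lra.
have := H _ t1; case/andP: t1; set t := _ / _ => t0 _.
have tE : t * (2 * (- a + `|b|)) = - a by rewrite /t; field; lra.
have := ler_norm b; have := normr_ge0 b; nra.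
Qed.

(** First-order optimality: compare [p] with p + t(y - p) and keep the term linear in t. In a run,
    [a] is the sum of the slopes of the linearized pieces. *)
Lemma prox_subdifferential h p c a :
    convex_function [set: convex_lmodType 'cV[R]_n] h ->
    (forall y, h p + 2^-1 * normD D (p - c) ^+ 2 <=
               h y + inner a (y - p) + 2^-1 * normD D (y - c) ^+ 2) ->
  subdifferential h p (- a - D *m (p - c)).
Proof.
move=> hc hmin y.
rewrite innerDl !innerNl (innerC (D *m _)).
suff : 0 <= h y - h p + inner a (y - p) + inner (y - p) (D *m (p - c)) by lra.
apply: (linear_coef_ge0 _ (2^-1 * normD D (y - p) ^+ 2)) => t t01.
have := convex_function_line h p y t hc ltac:(lra).
have := hmin (p + t *: (y - p)).
rewrite [_ + _ - p]addrAC subrr add0r [_ + _ - c]addrAC innerZr.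
rewrite (normD_sqrD hD (p - c)) (normD_sqrZ hD) innerZl; lra.
Qed.

(** Moving from [c] towards [y] by t costs only t^2 in the quadratic term, while convexity bounds
    the change of [h] linearly in t. *)
Lemma convex_argmin_prox h c :
    convex_function [set: convex_lmodType 'cV[R]_n] h ->
    (forall y, h c <= h y + 2^-1 * normD D (y - c) ^+ 2) ->
  Argmin h c.
Proof.
move=> hc hmin y; rewrite -subr_ge0.
apply: (linear_coef_ge0 _ (2^-1 * normD D (y - c) ^+ 2)) => t t01.
have := convex_function_line h c y t hc ltac:(lra).
have := hmin (c + t *: (y - c)).
rewrite [_ + _ - c]addrAC subrr add0r (normD_sqrZ hD); lra.
Qed.

(* The affine minorant is controlled on the ball by its value at [p] and its
   upper bounds at [w] and at the reflection of [w] in [p], so no bound on [g]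
   is needed. *)
Lemma linearization_error_le h v g p u (C M t : R) :
    convex_function [set: convex_lmodType 'cV[R]_n] h ->
    subdifferential h v g ->
    (forall y, normD D y ^+ 2 <= 2 * M + 2 -> `|h y| <= C) ->
    normD D p ^+ 2 <= M -> 0 < t <= 1 -> normD D (u - p) ^+ 2 <= t ^+ 2 ->
    h p - (h v + inner g (p - v)) <= t ->
  h u - (h v + inner g (u - v)) <= t * (4 * C + 3).
Proof.
move=> hc hg hC pM t01 ut pt.
have t_neq0 : t != 0 by lra.
pose d : 'cV[R]_n := t^-1 *: (u - p).
have d1 : normD D d ^+ 2 <= 1.
  rewrite (normD_sqrZ hD) exprVn mulrC ler_pdivrMr ?mul1r // exprn_gt0; lra.
have hpd y : normD D y ^+ 2 <= 1 -> `|h (p + y)| <= C.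
  by move=> y1; apply: hC; have := normD_sqrD_le hD p y; lra.
have uE : u = p + t *: ((p + d) - p).
  by rewrite [p + d]addrC addrK scalerA divff // scale1r addrC subrK.
clearbody d.
have := convex_function_line h p (p + d) t hc ltac:(lra); rewrite -uE.
have := hg (p - d).
have -> : u - v = (p - v) + t *: d.
  by rewrite {1}uE [p + d]addrC addrK addrAC.
have -> : p - d - v = (p - v) - d by rewrite addrAC.
rewrite !(innerDr (p - v)) innerNr innerZr.
have /hpd := d1; have /hpd : normD D (- d) ^+ 2 <= 1 by rewrite normD_sqrN.
have /hpd : normD D 0 ^+ 2 <= 1.
  by rewrite -(scale0r d) (normD_sqrZ hD) expr0n mul0r ler01.
rewrite addr0 !ler_norml => /andP[? ?] /andP[? ?] /andP[? ?] ? ?.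
(* The minorant at p - d gives -<g, d> <= h(p - d) - h(p) + t <= 2C + 1, and h(p + d) - h(p) <= 2C.
   The error at [p] adds the last t. *)
have : t * (h (p + d) - h p - inner g d) <= t * (4 * C + 2).
  by apply: ler_wpM2l; lra.
lra.
Qed.

End ConvexEllipsoid.

(** * Invariants of a SLIN run and the analysis of null steps *)

Section Run.
Context {R : realType} {n N : nat}.
Variables (f : 'I_N -> 'cV[R]_n -> R) (D : 'M[R]_n) (beta : R).
Variables (x : nat -> 'cV[R]_n) (j : nat -> 'I_N).
Variables (z g : nat -> 'I_N -> 'cV[R]_n).
Hypothesis hf : forall i, convex_function [set: convex_lmodType 'cV[R]_n] (f i).
Hypothesis hD : sympd D.
Hypothesis hbeta : 0 < beta < 1.
Hypothesis hrun : slin_run f D 0 beta x j z g.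

Local Notation performed := (performed f 0 x j z g).
Local Notation model := (model f j z g).
Local Notation lin := (lin f z g).
Local Notation prox := (prox j z).
Local Notation gap := (gap f x j z g).

(** The optimal value of the proximal subproblem when [k] is performed. *)
Let prox_value k : R :=
  model k (prox k) + 2^-1 * normD D (prox k - x k) ^+ 2.

Lemma convex_function_sum :
  convex_function [set: convex_lmodType 'cV[R]_n] (objective f).
Proof.
move=> t u v hu hv.
have <- : \sum_i (conv t (f i u : R^o) (f i v) : R) =
    conv t (objective f u : R^o) (objective f v).
  by rewrite convRE !mulr_sumr -big_split.
by apply: ler_sum => i _; exact: hf.
Qed.

Lemma performed1 : performed 1.
Proof. by split=> // l /andP[l1 /(leq_trans l1)]. Qed.

Lemma performed_le k l : (1 <= l <= k)%N -> performed k -> performed l.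
Proof.
move=> /andP[l1 lk] [_ hk]; split=> // i /andP[i1 il].
by apply: hk; rewrite i1 (leq_trans il).
Qed.

Lemma linB k i u v : lin k i u = lin k i v + inner (g k i) (u - v).
Proof.
have uE : u - z k i = (v - z k i) + (u - v) by rewrite [RHS]addrC addrA subrK.
by rewrite /Defs.lin uE (innerDr (v - _)) addrA.
Qed.

Lemma lin_prox k : lin k (j k) (prox k) = f (j k) (prox k).
Proof. by rewrite /Defs.lin /Defs.prox subrr /inner mulmx0 mxE addr0. Qed.

Lemma model_prox k : model k (prox k) = \sum_i lin k i (prox k).
Proof. by rewrite [RHS](bigD1 (j k)) //= lin_prox. Qed.

Lemma sum_linB k (P : pred 'I_N) u v :
  \sum_(i | P i) lin k i u =
  \sum_(i | P i) lin k i v + inner (\sum_(i | P i) g k i) (u - v).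
Proof.
by rewrite inner_suml -big_split; apply: eq_bigr => i _; exact: linB.
Qed.

(** The exact piece gets its subgradient from optimality of [prox k]; every other piece is inherited
    from the previous iteration or from the initial data. *)
Lemma slin_subdifferential k :
  performed k -> forall i, subdifferential (f i) (z k i) (g k i).
Proof.
have exact_piece l : performed l ->
    subdifferential (f (j l)) (z l (j l)) (g l (j l)).
  move=> pl; rewrite (slin_subgrad hrun pl).
  apply: prox_subdifferential => // y.
  have := slin_prox hrun pl y.
  rewrite /Defs.model -/(prox l) (sum_linB l _ y (prox l)); lra.
elim: k => [[]//|k IH] pk i.
have [->|ik] := eqVneq i (j k.+1); first exact: exact_piece.
have [k0|k1] := posnP k; first by move: ik; rewrite k0; exact: (slin_init hrun).
have pk' : performed k by apply: performed_le pk; rewrite k1 /=.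
have [-> ->] := slin_keep hrun pk k1 ik; exact: IH.
Qed.

Lemma model_le_objective k y : performed k -> model k y <= objective f y.
Proof.
move=> pk; rewrite /objective (bigD1 (j k)) //= lerD2l.
by apply: ler_sum => i _; exact: slin_subdifferential.
Qed.

(** With all pieces linearized, the left side is a quadratic with Hessian D. Its gradient vanishes
    at [prox k] because the slopes sum to -D(prox k - x k), so the expansion there is exact. *)
Lemma sum_linE k y : performed k ->
  \sum_i lin k i y + 2^-1 * normD D (y - x k) ^+ 2 =
  prox_value k + 2^-1 * normD D (y - prox k) ^+ 2.
Proof.
move=> pk.
have gE : \sum_i g k i = - (D *m (prox k - x k)).
  by rewrite (bigD1 (j k)) //= (slin_subgrad hrun pk) addrAC addNr add0r.
rewrite (sum_linB k xpredT y (prox k)) -model_prox /prox_value gE.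
have -> : y - x k = (prox k - x k) + (y - prox k).
  by rewrite [RHS]addrC addrA subrK.
rewrite (normD_sqrD hD (prox k - x k)) innerNl innerC; lra.
Qed.

Lemma prox_value_le k y : performed k ->
  prox_value k + 2^-1 * normD D (y - prox k) ^+ 2 <=
  objective f y + 2^-1 * normD D (y - x k) ^+ 2.
Proof.
move=> pk; rewrite -sum_linE // lerD2r.
by apply: ler_sum => i _; exact: slin_subdifferential.
Qed.

(** Model k+1 differs from the full linearization at k only in the piece [j k.+1], now exact; expand
    the latter at [prox k.+1]. *)
Lemma prox_valueS k : performed k.+1 -> (1 <= k)%N -> x k.+1 = x k ->
  prox_value k.+1 = prox_value k
    + 2^-1 * normD D (prox k.+1 - prox k) ^+ 2
    + (f (j k.+1) (prox k.+1) - lin k (j k.+1) (prox k.+1)).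
Proof.
move=> pk k1 xk.
have pk' : performed k by apply: performed_le pk; rewrite k1 /=.
rewrite -sum_linE // /prox_value xk /Defs.model.
rewrite [\sum_(i < N) _](bigD1 (j k.+1)) //=.
suff -> : \sum_(i | i != j k.+1) lin k.+1 i (prox k.+1) =
          \sum_(i | i != j k.+1) lin k i (prox k.+1) by lra.
apply: eq_bigr => i ij; rewrite /Defs.lin.
by have [-> ->] := slin_keep hrun pk k1 ij.
Qed.

(** F minus the model at [prox k] is a sum of N errors, the one of [j k] being zero and the others
    at most that of [j k.+1]. A failed descent test makes this sum exceed (1 - beta) times the
    gap. *)
Lemma null_step_gap_le k :
    performed k.+1 -> (1 <= k)%N -> x k.+1 = x k -> 0 < gap k ->
  (1 - beta) * gap k <=
  (f (j k.+1) (prox k) - lin k (j k.+1) (prox k)) *+ N.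
Proof.
move=> pk k1 xk gap0.
have pk' : performed k by apply: performed_le pk; rewrite k1 /=.
have [jk sel] := slin_select hrun pk k1.
set v := f _ _ - _ in sel *.
have v0 : 0 <= v by rewrite subr_ge0; exact: slin_subdifferential.
have : objective f (prox k) - model k (prox k) <= v *+ N.
  rewrite model_prox /objective -sumrB -[N in v *+ N]card_ord -sumr_const.
  apply: ler_sum => i _; have [->|/sel//] := eqVneq i (j k).
  by rewrite lin_prox subrr.
have := slin_center hrun pk k1; rewrite xk; case: ifPn => [le xE|].
  (* A descent step with [prox k = x k] also keeps the center, but a positive gap contradicts its
     test. *)
  by move: le; rewrite -xE; case/andP: hbeta => b0 _; nra.
by rewrite -ltNge; move: gap0; rewrite /Defs.gap; lra.
Qed.

(* The prox values increase and are bounded by [F (x m)], so their increments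
   cannot stay above a fixed positive bound. *)
Lemma null_steps_small_gap m e : (1 <= m)%N -> (forall k, (1 <= k)%N -> performed k) ->
    (forall k, (m <= k)%N -> x k = x m) -> 0 < e ->
  exists2 k, (m <= k)%N & gap k <= e.
Proof.
move=> m1 perf xm e0.
have k1 k : (m <= k)%N -> (1 <= k)%N by exact: leq_trans.
have xS k : (m <= k)%N -> x k.+1 = x k.
  by move=> mk; rewrite !xm // (leq_trans mk).
have value_step k (mk : (m <= k)%N) := 
    prox_valueS k (perf k.+1 isT) (k1 k mk) (xS k mk).
have lin_ge0 k i y : (m <= k)%N -> 0 <= f i y - lin k i y.
  by move=> /k1/perf pk; rewrite subr_ge0; exact: slin_subdifferential.
have value_ge k : (m <= k)%N -> prox_value m <= prox_value k.
  elim: k => [|k IH]; first by rewrite leqn0 => /eqP ->.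
  rewrite leq_eqVlt => /predU1P[->//|mk]; apply: le_trans (IH mk) _.
  rewrite value_step // -addrA lerDl addr_ge0 ?lin_ge0 // mulr_ge0 ?sqr_ge0 //; lra.
have value_le k : (m <= k)%N ->
    prox_value k + 2^-1 * normD D (prox k - x m) ^+ 2 <= objective f (x m).
  move=> mk; have := prox_value_le k (x m) (perf k (k1 k mk)).
  by rewrite xm // subrr -(normD_sqrN hD (prox k - _)) opprB
    -(scale0r (x m)) (normD_sqrZ hD) expr0n mul0r mulr0 addr0.
(* The bounds on [prox_value] give |prox k - x m|_D^2 <= 2 (F(x m) - prox_value m); adding back
   [x m] doubles this. *)
pose M := 4 * (objective f (x m) - prox_value m) + 2 * normD D (x m) ^+ 2.
have prox_le k : (m <= k)%N -> normD D (prox k) ^+ 2 <= M.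
  move=> mk; have := normD_sqrD_le hD (prox k - x m) (x m).
  by rewrite subrK /M; have := value_le k mk; have := value_ge k mk; lra.
have [A hA] := choice (fun i => convex_bounded (D := D) hD (f i) (2 * M + 2) (hf i)).
pose C := \sum_i `|A i|.
have hC i y : normD D y ^+ 2 <= 2 * M + 2 -> `|f i y| <= C.
  move=> yM; apply: le_trans (hA i y yM) _; rewrite /C (bigD1 i) //=.
  by rewrite (le_trans (ler_norm _)) // lerDl sumr_ge0.
have C0 : 0 <= C by apply: sumr_ge0.
case/andP: (hbeta) => b0 b1.
(* N errors of size t(4C + 3) must sum to at most (1 - beta) e; the summand 1 keeps [K] positive. *)
pose K := 1 + (4 * C + 3) *+ N.
have K0 : 1 <= K by rewrite /K lerDl mulrn_wge0 //; lra.
have K0' : 0 < K by lra.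
pose t := Num.min 1 ((1 - beta) * e / K).
have t01 : 0 < t <= 1.
  by rewrite /t ge_min lexx lt_min ltr01 divr_gt0 // mulr_gt0 //; lra.
have tK : t * K <= (1 - beta) * e.
  by rewrite -ler_pdivlMr // /t ge_min lexx orbT.
have [k mk incr] : exists2 k, (m <= k)%N &
    prox_value k.+1 - prox_value k <= 2^-1 * t ^+ 2.
  apply: contrapT => Hn.
  have big l : prox_value m + (2^-1 * t ^+ 2) *+ l <= prox_value (m + l)%N.
    elim: l => [|l IH]; first by rewrite mulr0n addr0 addn0.
    rewrite mulrSr addrA addnS.
    have : ~ (prox_value (m + l).+1 - prox_value (m + l)%N <= 2^-1 * t ^+ 2).
      by move=> H; apply: Hn; exists (m + l)%N; rewrite ?leq_addr.
    by move=> /negP; rewrite -ltNge; lra.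
  have t2 : 0 < 2^-1 * t ^+ 2 by rewrite mulr_gt0 ?exprn_gt0; lra.
  pose b := (objective f (x m) - prox_value m) / (2^-1 * t ^+ 2).
  pose l := Num.bound b.
  have : b < l%:R.
    apply: archi_boundP; rewrite divr_ge0 ?(ltW t2) // subr_ge0.
    apply: le_trans (value_le m (leqnn m)); rewrite lerDl.
    by rewrite mulr_ge0 ?sqr_ge0.
  rewrite ltr_pdivrMr // mulr_natl.
  have := big l; have := value_le (m + l)%N (leq_addr _ _).
  have := sqr_ge0 (normD D (prox (m + l)%N - x m)); lra.
exists k => //; rewrite leNgt; apply/negP => gapk.
have gap0 : 0 < gap k by lra.
have := null_step_gap_le k (perf k.+1 isT) (k1 k mk) (xS k mk) gap0.
move: (value_step k mk) incr => ->.
have := lin_ge0 k (j k.+1) (prox k.+1) mk.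
have := sqr_ge0 (normD D (prox k.+1 - prox k)).
set i := j k.+1 => d0 lin0 incr.
(* Both parts of the increment are nonnegative, so each is at most t^2/2: the prox points are within
   t, and the error at [prox k.+1] is at most t. *)
have err : f i (prox k) - lin k i (prox k) <= t * (4 * C + 3).
  apply: (linearization_error_le hD _ _ _ (prox k.+1) _ C M) => //.
  - exact: slin_subdifferential (perf k (k1 k mk)) i.
  - exact: hC.
  - by apply: prox_le; rewrite leqW.
  - rewrite -(normD_sqrN hD) opprB; lra.
  - have : t ^+ 2 <= t by nra.
    move: lin0 incr; rewrite /Defs.lin; lra.
have : (f i (prox k) - lin k i (prox k)) *+ N <= t * ((4 * C + 3) *+ N).
  by rewrite mulrnAr ler_wMn2r.
move: tK; rewrite /K; nra.
Qed.

(** Here [k] may depend on [e]: a stopping iteration serves every [e], an infinite run supplies one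
    for each. *)
Lemma small_gaps_argmin c :
    (forall e, 0 < e ->
      exists k, [/\ performed k, x k = c & gap k <= e]) ->
  Argmin (objective f) c.
Proof.
move=> small; apply: (convex_argmin_prox hD _ _ convex_function_sum) => y.
apply/ler_addgt0Pr => e /small[k [pk xk]].
have := slin_prox hrun pk y; rewrite -/(prox k) /Defs.gap xk.
have := model_le_objective k y pk; have := sqr_ge0 (normD D (prox k - c)).
lra.
Qed.

Lemma center_eventually_constant m :
    center_changes f 0 x j z g m ->
    ubound (center_changes f 0 x j z g) m ->
  forall k, (m <= k)%N -> performed k -> x k = x m.
Proof.
move=> hm hmax; elim=> [|k IH]; first by rewrite leqn0 => /eqP ->.
rewrite leq_eqVlt => /predU1P[->//|mk] pk.
have m1 : (1 <= m)%N by case: hm => [->//|[/ltnW]].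
have k1 : (1 <= k)%N by exact: leq_trans m1 mk.
rewrite -IH //; last by apply: performed_le pk; rewrite k1 /=.
apply/eqP; apply: contraT => xk.
have /hmax : center_changes f 0 x j z g k.+1 by right; split.
by rewrite leEnat leqNgt mk.
Qed.

End Run.

Theorem theorem3p3 (R : realType) (n N : nat) (hN : (2 <= N)%N)
    (f : 'I_N -> 'cV[R]_n -> R)
    (hf : forall i, convex_function [set: convex_lmodType 'cV[R]_n] (f i))
    (D : 'M[R]_n) (hD : sympd D)
    (beta : R) (hbeta : 0 < beta < 1)
    (x : nat -> 'cV[R]_n) (j : nat -> 'I_N) (z g : nat -> 'I_N -> 'cV[R]_n)
    (hrun : slin_run f D 0 beta x j z g)
    (hfin : finite_set (center_changes f 0 x j z g))
    (hinf : (-oo < ereal_inf (range (fun y => (objective f y)%:E)))%E)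
    (m : nat) (hm : center_changes f 0 x j z g m)
    (hmax : ubound (center_changes f 0 x j z g) m) :
  Argmin (objective f) (x m).
Proof.
have pm : performed f 0 x j z g m.
  by case: hm => [->|[]//]; exact: performed1.
have m1 := pm.1.
have xm := center_eventually_constant f x j z g m hm hmax.
apply: (small_gaps_argmin f D beta x j z g hf hD hrun) => e e0.
have [[k pk gk]|nstop] :=
    pselect (exists2 k, performed f 0 x j z g k & gap f x j z g k <= 0).
  exists k; split=> //; last by rewrite (le_trans gk) ?ltW.
  (* A stopping iteration before [m] would prevent [m] from being performed. *)
  apply: xm => //; rewrite leqNgt; apply/negP => km.
  by have := pm.2 k; rewrite km pk.1 ltNge gk => /(_ isT).
have perf k : (1 <= k)%N -> performed f 0 x j z g k.
  elim: k => // -[_ _|k IH _]; first exact: performed1.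
  have pk := IH isT; split=> // l /andP[l1].
  rewrite ltnS leq_eqVlt => /predU1P[->|lk]; last by apply: pk.2; rewrite l1.
  by rewrite ltNge; apply/negP => gk; apply: nstop; exists k.+1.
have xc k : (m <= k)%N -> x k = x m.
  by move=> mk; apply: xm => //; apply: perf; exact: leq_trans mk.
have [k mk gk] :=
  null_steps_small_gap f D beta x j z g hf hD hbeta hrun m e m1 perf xc e0.
by exists k; split; [exact: perf (leq_trans m1 mk) | exact: xc |].
Qed.
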